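(* Let $X$ be a non-empty set. A binary relation $R$ on $X$ has an interval order extension (not necessarily a strict linear order) if and only if $R$ is acyclic.
   Context: For a binary relation $R$ on a set $X$, the asymmetric part is $P(R)=\{(x,y)\in X\times X : (x,y)\in R \text{ and } (y,x)\notin R\}$. The transitive closure $\overline{R}$ is defined by: $(x,y)\in\overline{R}$ iff there exist $m\geq 1$ and $z_0,\dots,z_m\in X$ with $x=z_0$, $z_m=y$ and $(z_k,z_{k+1})\in R$ for all $0\le k\le m-1$. An $R$-cycle is a non-empty subset $Y\subseteq X$ such that $(x,y)\in\overline{R}$ and $(y,x)\in\overline{R}$ for all $x,y\in Y$; $R$ is acyclic if there is no $R$-cycle. A relation $R^*$ on $X$ is an extension of $R$ if $R\subseteq R^*$ and $P(R)\subseteq P(R^* )$. A strict partial order is an irreflexive and transitive relation; a strict linear order is a strict partial order that is total (for all $x\neq y$, $xRy$ or $yRx$). An interval order is a strict partial order $R$ satisfying the Russell-Wiener axiom: for all $x,y,z,w\in X$, $(x,y)\in R$, $(z,y)\notin R$ and $(z,w)\in R$ imply $(x,w)\in R$. ''Not necessarily a strict linear order'' only means that the extension is not required to be total. *)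

(* Defs.v *)
From Stdlib Require Import Relations RelationClasses Ensembles Arith Lia.

Set Implicit Arguments.

Definition asym_part (X : Type) (R : relation X) : relation X :=
  fun x y => R x y /\ ~ R y x.

(* The transitive closure of [R] is [clos_trans X R]; this is its description
   by finite chains [x = z 0, z 1, ..., z m = y] with [m >= 1]. *)
Lemma clos_trans_chain (X : Type) (R : relation X) (x y : X) :
  clos_trans X R x y <->
  exists (m : nat) (z : nat -> X),
    1 <= m /\ z 0 = x /\ z m = y /\ forall k, k <= m - 1 -> R (z k) (z (S k)).
Proof.
split.
- intros H; apply clos_trans_t1n in H.
  induction H as [x y Hxy | x y w Hxy _ IH].
  + exists 1, (fun k => match k with 0 => x | _ => y end).
    repeat split; auto.
    intros k Hk; replace k with 0 by lia; exact Hxy.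
  + destruct IH as (m & z & Hm & Hz0 & Hzm & Hz).
    exists (S m), (fun k => match k with 0 => x | S j => z j end).
    repeat split; [lia | exact Hzm |].
    intros [|k] Hk; [rewrite Hz0; exact Hxy | apply Hz; lia].
- intros (m & z & Hm & <- & <- & Hz).
  destruct m as [|m]; [lia |]; clear Hm.
  induction m as [|m IH].
  + apply t_step, Hz; lia.
  + apply t_trans with (z (S m)).
    * apply IH; intros k Hk; apply Hz; lia.
    * apply t_step, Hz; lia.
Qed.

Definition is_cycle (X : Type) (R : relation X) (Y : Ensemble X) : Prop :=
  Inhabited X Y /\
  forall x y, In X Y x -> In X Y y -> clos_trans X R x y /\ clos_trans X R y x.

Definition acyclic (X : Type) (R : relation X) : Prop :=
  ~ exists Y : Ensemble X, is_cycle R Y.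

Definition is_extension (X : Type) (R Rs : relation X) : Prop :=
  inclusion X R Rs /\ inclusion X (asym_part R) (asym_part Rs).

Definition russell_wiener (X : Type) (R : relation X) : Prop :=
  forall x y z w, R x y -> ~ R z y -> R z w -> R x w.

Definition interval_order (X : Type) (R : relation X) : Prop :=
  StrictOrder R /\ russell_wiener R.

(* Main.v *)
Require Import Defs.
From Stdlib Require Import Relations RelationClasses Ensembles Classical.
From mathcomp Require classical_sets.

(** An interval order that contains [R] is transitive and irreflexive, so it
    leaves no room for a cycle of [R].  Conversely, strict linear orders are
    interval orders ([strict_linear_interval_order]), so it is enough to
    extend an acyclic relation to a strict linear order: this is Szpilrajn's
    theorem, started from acyclicity rather than from a strict partial order
    ([acyclic_linear_extension]).

    Acyclicity says that the transitive closure is irreflexive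
    ([acyclic_irreflexive]).  A cycle is a finite object, so acyclicity passes
    to unions of chains, and Zorn's lemma gives a maximal set of pairs that can
    be added to [R] without creating a cycle.  The transitive closure of the
    enlarged relation is then total, because a pair [(a, b)] creates a cycle
    only if [b] already reaches [a] ([acyclic_add_pair]). *)

(** Any point that reaches itself is a cycle on its own. *)
Lemma acyclic_irreflexive (X : Type) (R : relation X) :
  acyclic R <-> forall x, ~ clos_trans X R x x.
Proof.
split.
- intros HR x Hx; apply HR.
  exists (Singleton X x); split; [exists x; constructor |].
  intros y z [] []; auto.
- intros HR (Y & [x Hx] & HY).
  exact (HR x (proj1 (HY x x Hx Hx))).
Qed.

(** In an asymmetric relation every pair belongs to the asymmetric part, so
    plain inclusion is all that an extension requires. *)
Lemma strict_order_extension (X : Type) (R S : relation X) :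
  StrictOrder S -> inclusion X R S -> is_extension R S.
Proof.
intros [Sirr Strans] HRS; split; [exact HRS |].
intros x y [Hxy _]; split; [now apply HRS |].
intros Hyx; exact (Sirr x (Strans _ _ _ (HRS _ _ Hxy) Hyx)).
Qed.

Lemma clos_trans_sub_transitive (X : Type) (R S : relation X) :
  Transitive S -> inclusion X R S -> inclusion X (clos_trans X R) S.
Proof.
intros Strans HRS x y H; induction H as [x y H | x y z _ IH1 _ IH2].
- now apply HRS.
- exact (Strans _ _ _ IH1 IH2).
Qed.

Lemma clos_trans_incl (X : Type) (R S : relation X) :
  inclusion X R S -> inclusion X (clos_trans X R) (clos_trans X S).
Proof.
intros HRS; apply clos_trans_sub_transitive.
- intros x y z; apply t_trans.
- intros x y H; apply t_step; now apply HRS.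
Qed.

Lemma clos_refl_trans_cases (X : Type) (R : relation X) (x y : X) :
  clos_refl_trans X R x y -> x = y \/ clos_trans X R x y.
Proof.
intros H; induction H as [x y H | x | x y z _ [<- | H1] _ [<- | H2]]; auto.
- right; now apply t_step.
- right; now apply t_trans with y.
Qed.

(** A chain of steps that uses the new pair [(a, b)] can be cut before its first
    and after its last use, which leaves two chains of old steps. *)
Lemma clos_trans_add_pair (X : Type) (R : relation X) (a b x y : X) :
  clos_trans X (union X R (fun u v => u = a /\ v = b)) x y ->
  clos_trans X R x y \/ (clos_refl_trans X R x a /\ clos_refl_trans X R b y).
Proof.
intros H; induction H as [x y [H | [-> ->]] | x y z _ IH1 _ IH2].
- left; now apply t_step.
- right; split; apply rt_refl.
- destruct IH1 as [H1 | [H1 H1']], IH2 as [H2 | [H2 H2']].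
  + left; now apply t_trans with y.
  + right; split; [| exact H2'].
    apply rt_trans with y; [now apply clos_t_clos_rt | exact H2].
  + right; split; [exact H1 |].
    apply rt_trans with y; [exact H1' | now apply clos_t_clos_rt].
  + now right.
Qed.

Lemma acyclic_add_pair (X : Type) (R : relation X) (a b : X) :
  acyclic R -> ~ clos_refl_trans X R b a ->
  acyclic (union X R (fun u v => u = a /\ v = b)).
Proof.
rewrite !acyclic_irreflexive; intros HR Hba x Hx.
apply clos_trans_add_pair in Hx as [Hx | [Hxa Hbx]].
- exact (HR x Hx).
- apply Hba; now apply rt_trans with x.
Qed.

Definition add_pairs (X : Type) (R : relation X) (A : X * X -> Prop) :
  relation X := union X R (fun x y => A (x, y)).

Lemma add_pairs_incl (X : Type) (R : relation X) (A B : X * X -> Prop) :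
  classical_sets.subset A B ->
  inclusion X (add_pairs X R A) (add_pairs X R B).
Proof. intros HAB x y [H | H]; [now left | right; now apply HAB]. Qed.

(** A chain of steps uses finitely many pairs, and the largest of the members
    of [F] they come from contains them all.  The first alternative is there
    because [F] may be empty. *)
Lemma clos_trans_add_bigcup (X : Type) (R : relation X)
    (F : (X * X -> Prop) -> Prop) (x y : X) :
  classical_sets.total_on F classical_sets.subset ->
  clos_trans X (add_pairs X R (classical_sets.bigcup F (fun A => A))) x y ->
  clos_trans X R x y \/ exists A, F A /\ clos_trans X (add_pairs X R A) x y.
Proof.
intros Ftot H; induction H as [x y [H | [A FA H]] | x y z _ IH1 _ IH2].
- left; now apply t_step.
- right; exists A; split; [exact FA | apply t_step; now right].
- assert (Hinl : forall A, inclusion X (clos_trans X R)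
                             (clos_trans X (add_pairs X R A))).
  { intros A; apply clos_trans_incl; intros u v Huv; now left. }
  destruct IH1 as [H1 | (A & FA & H1)], IH2 as [H2 | (B & FB & H2)].
  + left; now apply t_trans with y.
  + right; exists B; split; [exact FB |].
    apply t_trans with y; [now apply Hinl | exact H2].
  + right; exists A; split; [exact FA |].
    apply t_trans with y; [exact H1 | now apply Hinl].
  + right; destruct (Ftot A B FA FB) as [HAB | HBA].
    * exists B; split; [exact FB |]; apply t_trans with y; [| exact H2].
      exact (clos_trans_incl _ _ _ (add_pairs_incl X R A B HAB) _ _ H1).
    * exists A; split; [exact FA |]; apply t_trans with y; [exact H1 |].
      exact (clos_trans_incl _ _ _ (add_pairs_incl X R B A HBA) _ _ H2).
Qed.

(** Zorn's lemma is applied to sets of added pairs, not to the relations that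
    contain [R]: the union of the empty chain then gives back [R] itself. *)
Lemma maximal_acyclic_add_pairs (X : Type) (R : relation X) :
  acyclic R ->
  exists A, acyclic (add_pairs X R A) /\
    forall B, classical_sets.proper A B -> ~ acyclic (add_pairs X R B).
Proof.
intros HR.
apply (@classical_sets.Zorn_bigcup (X * X)
         (fun A => acyclic (add_pairs X R A))).
intros F Facyc Ftot; apply acyclic_irreflexive; intros x Hx.
apply clos_trans_add_bigcup in Hx as [Hx | (A & FA & Hx)]; [| | exact Ftot].
- exact (proj1 (acyclic_irreflexive X R) HR x Hx).
- exact (proj1 (acyclic_irreflexive X _) (Facyc A FA) x Hx).
Qed.

Lemma acyclic_linear_extension (X : Type) (R : relation X) :
  acyclic R ->
  exists L : relation X, inclusion X R L /\ StrictOrder L /\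
    forall x y, x <> y -> L x y \/ L y x.
Proof.
intros HR; destruct (maximal_acyclic_add_pairs X R HR) as (A & HA & Amax).
exists (clos_trans X (add_pairs X R A)); split; [| split; [split |]].
- intros x y H; apply t_step; now left.
- intros x; exact (proj1 (acyclic_irreflexive X _) HA x).
- intros x y z; apply t_trans.
- intros x y Hxy.
  destruct (classic (clos_refl_trans X (add_pairs X R A) y x)) as [Hyx | Hyx].
  { apply clos_refl_trans_cases in Hyx as [-> | Hyx]; [easy | now right]. }
  left; apply t_step; right; apply NNPP; intros HnA.
  (* Adding [(x, y)] keeps the relation acyclic, against maximality of [A]. *)
  apply (Amax (fun p => A p \/ p = (x, y))).
  + split; [now left |].
    intros Hsub; apply HnA, Hsub; now right.
  + pose proof (acyclic_add_pair X _ x y HA Hyx) as Hacyc.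
    rewrite acyclic_irreflexive in Hacyc |- *; intros z Hz; apply (Hacyc z).
    revert Hz; apply clos_trans_incl; intros u v [H | [H | H]].
    * left; now left.
    * left; now right.
    * right; now injection H.
Qed.

(** If [x] is below [y] and [z] is not, then [y] is equal to [z] or below it,
    hence [x] is below everything that [z] is below. *)
Lemma strict_linear_interval_order (X : Type) (L : relation X) :
  StrictOrder L -> (forall x y, x <> y -> L x y \/ L y x) -> interval_order L.
Proof.
intros HL Ltot; split; [exact HL |].
intros x y z w Hxy Hzy Hzw.
destruct (classic (y = z)) as [<- | Hyz].
- now transitivity y.
- destruct (Ltot y z Hyz) as [Hyz' | Hzy']; [| contradiction].
  transitivity y; [exact Hxy |]; now transitivity z.
Qed.

Theorem theorem3p5 (X : Type) (hX : inhabited X) (R : relation X) :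
  (exists Rs : relation X, is_extension R Rs /\ interval_order Rs) <-> acyclic R.
Proof.
split.
- intros (S & [HRS _] & [[Sirr Strans] _]); apply acyclic_irreflexive.
  intros x Hx; apply (Sirr x).
  exact (clos_trans_sub_transitive X R S Strans HRS x x Hx).
- intros HR; destruct (acyclic_linear_extension X R HR) as (L & HRL & HL & Ltot).
  exists L; split.
  + now apply strict_order_extension.
  + now apply strict_linear_interval_order.
Qed.
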